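(* Every torsion-free algebraically hyperbolic (AH) group is CSA.
   Context: A group is locally cyclic if each of its non-trivial finitely generated subgroups is isomorphic to $\mathbb{Z}$ (equivalently, it is isomorphic to a subgroup of $(\mathbb{Q},+)$). A group $G$ is commutative-transitive if for all $g,h,k\in G\smallsetminus\{1\}$, $[g,h]=1$ and $[h,k]=1$ imply $[g,k]=1$. A torsion-free group $G$ is algebraically hyperbolic (AH) if (a) $G$ is commutative-transitive, and (b) $G$ contains no subgroup of the form $H\rtimes\mathbb{Z}$ with $H$ non-trivial locally cyclic. A subgroup $M$ of a group $G$ is malnormal if $M^g\cap M=1$ for all $g\in G\smallsetminus M$, where $M^g=g^{-1}Mg$. A group $G$ is CSA (conjugacy separated abelian) if all maximal abelian subgroups of $G$ are malnormal in $G$. *)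

(* Defs.v *)
From mathcomp Require Import all_boot all_algebra.
From mathcomp Require Import monoid.
From mathcomp Require Import boolp classical_sets.

Set Implicit Arguments.
Unset Strict Implicit.
Unset Printing Implicit Defensive.

Local Open Scope classical_set_scope.
Local Open Scope group_scope.

(* Groups are arbitrary, possibly infinite, [groupType]s; subgroups are
   Prop-valued subsets, so that no decidability of membership is assumed. *)

Definition is_subgroup (G : groupType) (H : set G) : Prop :=
  [/\ H 1, (forall x y, H x -> H y -> H (x * y)) & (forall x, H x -> H x^-1)].

Definition generated (G : groupType) (S : set G) : set G :=
  smallest (@is_subgroup G) S.

Definition finitely_generated (G : groupType) (H : set G) : Prop :=
  exists s : seq G, H = generated [set` s].

(* [f] is an isomorphism from the additive group [int] onto [H]. *)
Definition isomorphic_to_Z (G : groupType) (H : set G) : Prop :=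
  exists f : int -> G,
    [/\ {morph f : m n / (m + n)%R >-> m * n}, injective f & range f = H].

Definition locally_cyclic (G : groupType) (H : set G) : Prop :=
  forall K : set G, is_subgroup K -> K `<=` H -> K <> [set 1] ->
    finitely_generated K -> isomorphic_to_Z K.

Definition torsion_free (G : groupType) : Prop :=
  forall (x : G) (n : nat), (0 < n)%N -> x ^+ n = 1 -> x = 1.

Definition commutative_transitive (G : groupType) : Prop :=
  forall g h k : G, g <> 1 -> h <> 1 -> k <> 1 ->
    [~ g, h] = 1 -> [~ h, k] = 1 -> [~ g, k] = 1.

(* M^g = g^-1 M g, since [x ^ g] is [g^-1 * (x * g)]. *)
Definition conj_set (G : groupType) (M : set G) (g : G) : set G :=
  [set x ^ g | x in M].

Definition normal_in (G : groupType) (H K : set G) : Prop :=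
  H `<=` K /\ forall g, K g -> conj_set H g = H.

(* The subgroup [K] is the internal semidirect product of [H] (normal) by [C];
   a trivial action, i.e. a direct product, is allowed. *)
Definition semidirect_product (G : groupType) (K H C : set G) : Prop :=
  [/\ [/\ is_subgroup K, is_subgroup H & is_subgroup C],
      normal_in H K,
      [set h * c | h in H & c in C] = K
    & H `&` C = [set 1]].

(* To be used for torsion-free groups only. *)
Definition algebraically_hyperbolic (G : groupType) : Prop :=
  commutative_transitive G /\
  ~ (exists K H C : set G,
      [/\ semidirect_product K H C, H <> [set 1], locally_cyclic H
        & isomorphic_to_Z C]).

Definition abelian_set (G : groupType) (A : set G) : Prop :=
  forall x y, A x -> A y -> commute x y.

Definition maximal_abelian_subgroup (G : groupType) (M : set G) : Prop :=
  [/\ is_subgroup M, abelian_set M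
    & forall N : set G, is_subgroup N -> abelian_set N -> M `<=` N -> N = M].

Definition malnormal (G : groupType) (M : set G) : Prop :=
  forall g : G, ~ M g -> conj_set M g `&` M = [set 1].

Definition CSA (G : groupType) : Prop :=
  forall M : set G, maximal_abelian_subgroup M -> malnormal M.

(* Main.v *)
Require Import Defs.
From mathcomp Require Import all_boot all_algebra.
From mathcomp Require Import monoid.
From mathcomp Require Import boolp classical_sets.

Set Implicit Arguments.
Unset Strict Implicit.
Unset Printing Implicit Defensive.

Local Open Scope classical_set_scope.
Local Open Scope group_scope.

(** In a commutative-transitive group a maximal abelian subgroup [M] is the
    centralizer of each of its nontrivial elements
    ([maximal_abelian_centralizer]).  Suppose that [M] meets [M ^ g]
    nontrivially for some [g] outside [M].  Both are then the centralizer of a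
    common nontrivial element, so [g] normalizes [M]; and no nontrivial power
    of [g] lies in [M], since [g] would centralize it.  By torsion-freeness
    [g] generates a copy of the integers, and it spans with [M] the semidirect
    product of [M] by this copy.

    This contradicts the second axiom as soon as [M] is locally cyclic, which
    follows from the same axiom.  A direct product of two infinite cyclic
    groups is also a semidirect product of a nontrivial locally cyclic group by
    the integers, so any two commuting elements satisfy a nontrivial relation
    [x ^ m = y ^ n] ([AH_dependent]).  Without torsion the exponents in such a
    relation may be taken coprime, and a Bezout identity then provides a common
    root of [x] and [y] ([common_root]); adding generators one at a time,
    every finitely generated subgroup of [M] is cyclic
    ([locally_cyclic_of_dependent]). *)

(** * Integer powers in a group *)

Definition expgz (G : groupType) (x : G) (n : int) : G :=
  match n with Posz k => x ^+ k | Negz k => x ^- k.+1 end.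

Lemma expgz_succ (G : groupType) (x : G) (n : int) :
  expgz x (n + 1)%R = expgz x n * x.
Proof.
case: n => [n|[|n]].
- by rewrite -PoszD addn1 /= expgSr.
- by rewrite /= mulVg.
- have -> : (Negz n.+1 + 1 = Negz n)%R.
    by rewrite !NegzE [in LHS]intS GRing.opprD GRing.addrAC GRing.addNr GRing.add0r.
  by rewrite /expgz [in RHS]expgS invgM mulgVK.
Qed.

Lemma expgzD (G : groupType) (x : G) :
  {morph expgz x : m n / (m + n)%R >-> m * n}.
Proof.
move=> m; elim/int_ind => [|n IH|n IH].
- by rewrite GRing.addr0 /= mulg1.
- by rewrite -addn1 PoszD GRing.addrA !expgz_succ IH mulgA.
- have e : (- n%:Z = - n.+1%:Z + 1)%R.
    by rewrite intS GRing.opprD GRing.addrAC GRing.addNr GRing.add0r.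
  by move: IH; rewrite e GRing.addrA !expgz_succ mulgA => /mulIg.
Qed.

Lemma expgzN (G : groupType) (x : G) (n : int) :
  expgz x (- n)%R = (expgz x n)^-1.
Proof.
by apply/esym/mulg1_eq; rewrite -expgzD GRing.addrN.
Qed.

Lemma expgzM (G : groupType) (x : G) (m n : int) :
  expgz x (m * n)%R = expgz (expgz x m) n.
Proof.
elim/int_ind: n => [|n IH|n IH].
- by rewrite GRing.mulr0.
- by rewrite -addn1 PoszD GRing.mulrDr GRing.mulr1 !expgzD IH.
- by rewrite -addn1 PoszD GRing.opprD !GRing.mulrDr GRing.mulrN1 !expgzD IH !expgzN.
Qed.

Lemma expg1z (G : groupType) (n : int) : expgz 1 n = 1 :> G.
Proof. by case: n => n; rewrite /expgz expg1n ?invg1. Qed.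

Lemma commute_expgz (G : groupType) (x y : G) (n : int) :
  commute x y -> commute x (expgz y n).
Proof.
by move=> cxy; case: n => n; [|apply: commuteV]; apply: commuteX.
Qed.

Lemma expgzMl (G : groupType) (x y : G) (n : int) :
  commute x y -> expgz (x * y) n = expgz x n * expgz y n.
Proof.
move=> cxy; case: n => n; rewrite /expgz expgMn // invgM.
by apply/commuteV/commute_sym/commuteV/commuteX2.
Qed.

Lemma expgz_eq1 (G : groupType) (x : G) (n : int) :
  torsion_free G -> expgz x n = 1 -> n <> 0%R -> x = 1.
Proof.
move=> htf; case: n => [[|n]|n] //= e _; apply: (htf x n.+1) => //.
by rewrite -[LHS]invgK e invg1.
Qed.

(** * Subgroups *)

Lemma expgz_in (G : groupType) (H : set G) (x : G) (n : int) :
  is_subgroup H -> H x -> H (expgz x n).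
Proof.
move=> [H1 HM HV] Hx.
have HX k : H (x ^+ k) by elim: k => [|k IH]; rewrite ?expgS //; apply: HM.
by case: n => n; [|apply: HV]; apply: HX.
Qed.

Lemma cyclic_subgroup (G : groupType) (x : G) :
  is_subgroup (range (expgz x)).
Proof.
split; first by exists 0%R.
- by move=> _ _ [m _ <-] [n _ <-]; exists (m + n)%R; rewrite ?expgzD.
- by move=> _ [m _ <-]; exists (- m)%R; rewrite ?expgzN.
Qed.

Lemma cyclic_iso_Z (G : groupType) (x : G) :
  torsion_free G -> x <> 1 -> isomorphic_to_Z (range (expgz x)).
Proof.
move=> htf x1; exists (expgz x); split => //; first exact: expgzD.
move=> m n e; apply: contrapT => nmn; apply: x1.
apply: (@expgz_eq1 _ _ (m - n)%R htf); first by rewrite expgzD expgzN e mulgV.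
by move/eqP; rewrite GRing.subr_eq0 => /eqP.
Qed.

Definition normalizes (G : groupType) (H : set G) (g : G) : Prop :=
  forall h, H (h ^ g) <-> H h.

Lemma normalizer_subgroup (G : groupType) (H : set G) :
  is_subgroup (normalizes H).
Proof.
split.
- by move=> h; rewrite conjg1.
- by move=> x y nx ny h; rewrite conjgM; split=> [/ny/nx|/nx/ny].
- by move=> x nx h; rewrite -(nx (h ^ x^-1)) conjgKV.
Qed.

Lemma normalizes_conj_set (G : groupType) (H : set G) (g : G) :
  normalizes H g -> conj_set H g = H.
Proof.
move=> ng; apply/seteqP; split=> [_ [h Hh <-]|h Hh]; first exact/ng.
by exists (h ^ g^-1); rewrite ?conjgKV //; apply/ng; rewrite conjgKV.
Qed.

Lemma subgroup_normalizes (G : groupType) (H : set G) (g : G) :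
  is_subgroup H -> H g -> normalizes H g.
Proof.
move=> [_ HM HV] Hg h; split=> Hh; last by apply: (HM _ _ (HV _ Hg)); apply: HM.
rewrite -(conjgK g h) [_ ^ g^-1]conjgE invgK.
exact: (HM _ _ Hg (HM _ _ Hh (HV _ Hg))).
Qed.

(** The shape in which both forbidden subgroups are produced: normality of [H]
    in the product follows from [H] and [C] lying in the normalizer of [H],
    which is a subgroup. *)
Lemma semidirect_of_normalizes (G : groupType) (H C : set G) :
    is_subgroup H -> is_subgroup C -> (C `<=` normalizes H) ->
    (forall x, H x -> C x -> x = 1) ->
  semidirect_product [set h * c | h in H & c in C] H C.
Proof.
move=> sH sC nHC tI; have [H1 HM HV] := sH; have [C1 CM CV] := sC.
have nK : [set h * c | h in H & c in C] `<=` normalizes H.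
  move=> _ [h Hh [c Cc <-]]; have [_ nM _] := normalizer_subgroup H.
  by apply: nM; [apply: subgroup_normalizes|apply: nHC].
split=> //.
- split=> //; split.
  + by exists 1 => //; exists 1; rewrite ?mulg1.
  + move=> _ _ [h Hh [c Cc <-]] [h' Hh' [c' Cc' <-]].
    exists (h * h' ^ c^-1); first by apply: HM => //; apply/nHC/Hh'/CV.
    by exists (c * c'); [apply: CM|rewrite -!mulgA [in RHS](mulgA c) (conjgCV c h') -!mulgA].
  + move=> _ [h Hh [c Cc <-]].
    exists (h^-1 ^ c); first by apply/nHC/HV.
    by exists c^-1; [apply: CV|rewrite conjgE mulgA mulgK invgM].
- split=> [h Hh|g Kg]; first by exists h => //; exists 1; rewrite ?mulg1.
  exact/normalizes_conj_set/nK.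
- apply/seteqP; split=> [x [Hx Cx]|x ->]; last by split.
  exact: tI.
Qed.

(** * Local cyclicity *)

(** This is linear dependence over the integers, written multiplicatively. *)
Definition dependent (G : groupType) (x y : G) : Prop :=
  exists m n : int, (m, n) <> (0, 0)%R /\ expgz x m = expgz y n.

(** Dividing the exponents by their gcd [d] is legitimate since the [d]-th power
    map is injective on commuting elements of a torsion-free group.  From
    [x ^ m' = y ^ n'] and [u * m' + v * n' = 1], the element
    [w = x ^ v * y ^ u] satisfies [w ^ n' = x] and [w ^ m' = y].  The root is
    given in this form to show that it lies in the subgroup generated by [x]
    and [y]. *)
Lemma common_root (G : groupType) (x y : G) :
    torsion_free G -> commute x y -> dependent x y ->
  exists u v : int, let w := expgz x v * expgz y u in
    range (expgz w) x /\ range (expgz w) y.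
Proof.
move=> htf cxy [m [n [mn0 e]]].
set d := gcdz m n.
have d0 : d <> 0%R.
  move=> /eqP; rewrite gcdz_eq0 => /andP[/eqP m0 /eqP n0].
  by apply: mn0; rewrite m0 n0.
have [m' em] : exists m', m = (m' * d)%R by apply/dvdzP/dvdz_gcdl.
have [n' en] : exists n', n = (n' * d)%R by apply/dvdzP/dvdz_gcdr.
have e' : expgz x m' = expgz y n'.
  apply/divg1_eq/(expgz_eq1 htf _ d0).
  rewrite expgzMl; last by apply/commuteV/commute_expgz/commute_sym/commute_expgz/commute_sym.
  by rewrite -expgzN -!expgzM GRing.mulNr -em -en expgzN e mulgV.
have [u [v euv]] := Bezoutz m n.
have uv1 : (u * m' + v * n' = 1)%R.
  apply: (@GRing.mulIf _ d); first exact/eqP.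
  by rewrite GRing.mulrDl -!GRing.mulrA -em -en euv GRing.mul1r.
have cw : commute (expgz x v) (expgz y u).
  exact/commute_expgz/commute_sym/commute_expgz/commute_sym.
exists u, v => /=; split.
- exists n' => //; rewrite expgzMl // -!expgzM [(u * n')%R]GRing.mulrC.
  by rewrite [expgz y _]expgzM -e' -expgzM -expgzD GRing.addrC (GRing.mulrC m') uv1.
- exists m' => //; rewrite expgzMl // -!expgzM [(v * m')%R]GRing.mulrC.
  by rewrite [expgz x _]expgzM e' -expgzM -expgzD GRing.addrC (GRing.mulrC n') uv1.
Qed.

(** A finite list of elements of [K] lies in the cyclic group of a single
    element of [K], by induction on the list: the root [z] found for the tail
    and the new element [x] have a common root. *)
Lemma locally_cyclic_of_dependent (G : groupType) (H : set G) :
    torsion_free G -> abelian_set H ->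
    (forall x y, H x -> H y -> dependent x y) ->
  locally_cyclic H.
Proof.
move=> htf abH depH K sK KH K1 [s Ks].
have genK x : x \in s -> K x by move=> xs; rewrite Ks => A [_]; apply.
suff [z Kz sz] : exists2 z, K z & [set` s] `<=` range (expgz z).
  have eK : K = range (expgz z).
    apply/seteqP; split; last by move=> _ [n _ <-]; apply: expgz_in.
    by rewrite {1}Ks; apply: smallest_sub => //; exact: cyclic_subgroup.
  rewrite eK; apply: cyclic_iso_Z => // z1; apply: K1; rewrite eK z1.
  by apply/seteqP; split=> [_ [n _ <-]|_ ->]; [rewrite expg1z|exists 0%R].
clear Ks; elim: s genK => [|x s IH] genK.
  by exists 1; [case: sK|].
have [y ys|z Kz sz] := IH; first by apply: genK; rewrite inE ys orbT.
have Kx : K x by apply: genK; rewrite mem_head.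
have [u [v [wx wz]]] := common_root htf (abH _ _ (KH _ Kx) (KH _ Kz))
  (depH _ _ (KH _ Kx) (KH _ Kz)).
set w := (_ * _) in wx wz.
exists w; first by case: (sK) => _ KM _; apply: KM; apply: expgz_in.
move=> y /=; rewrite inE => /orP[/eqP -> //|/sz [n _ <-]].
exact: expgz_in (cyclic_subgroup w) wz.
Qed.

(** * Algebraically hyperbolic groups *)

(** Two commuting elements without a relation span the direct product of two
    infinite cyclic groups, which is one of the excluded semidirect products. *)
Lemma AH_dependent (G : groupType) (x y : G) :
    torsion_free G -> algebraically_hyperbolic G -> commute x y ->
  dependent x y.
Proof.
move=> htf [_ noHZ] cxy; apply: contrapT => indep.
have indep0 m n : expgz x m = expgz y n -> m = 0%R /\ n = 0%R.
  move=> e; suff [-> ->] : (m, n) = (0%R, 0%R) by [].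
  by apply: contrapT => mn; apply: indep; exists m, n.
have x1 : x <> 1 by move=> x1; have [] // := indep0 1%R 0%R.
have y1 : y <> 1 by move=> y1; have [] // := indep0 0%R 1%R.
apply: noHZ; pose X := range (expgz x); pose Y := range (expgz y).
exists [set h * c | h in X & c in Y], X, Y; split.
- apply: semidirect_of_normalizes; try exact: cyclic_subgroup.
  + move=> _ [n _ <-].
    apply: expgz_in (normalizer_subgroup X) _ => h.
    have cyX k : commute (expgz x k) y by exact/commute_sym/commute_expgz/commute_sym.
    have fixX k : expgz x k ^ y = expgz x k by rewrite conjgE cyX mulKg.
    split=> [[k _ ek]|[k _ <-]]; exists k => //.
    by apply: (@conjg_inj _ y); rewrite fixX.
  + by move=> _ [m _ <-] [n _ /esym e]; have [-> _] := indep0 _ _ e.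
- by move=> X1; apply: x1; suff: [set 1] x by []; rewrite -X1; exists 1%R.
- apply: locally_cyclic_of_dependent => //.
  + move=> _ _ [m _ <-] [n _ <-].
    exact/commute_expgz/commute_sym/commute_expgz.
  + move=> _ _ [m _ <-] [n _ <-].
    (* [(n, m)] is a relation between [x ^ m] and [x ^ n] unless [m = n = 0]. *)
    have [->|m0] := pselect (m = 0%R); first by exists 1%R, 0%R.
    by exists n, m; rewrite -!expgzM GRing.mulrC; split=> // -[].
- exact: cyclic_iso_Z.
Qed.

(** By commutative transitivity the centralizer of [x] is abelian; it contains
    [M], so maximality makes it equal to [M]. *)
Lemma maximal_abelian_centralizer (G : groupType) (M : set G) (x y : G) :
    commutative_transitive G -> maximal_abelian_subgroup M ->
    M x -> x <> 1 -> commute x y -> M y.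
Proof.
move=> CT [sM abM maxM] Mx x1 cxy.
suff <- : (commute x : set G) = M by [].
apply: maxM; last by move=> z Mz; apply: abM.
- split; [exact: commute1 | exact: commuteM | exact: commuteV].
move=> a b xa xb.
have [->|a1] := pselect (a = 1); first exact/commute_sym/commute1.
have [->|b1] := pselect (b = 1); first exact/commute1.
by apply/commgP/eqP; apply: (CT a x b) => //; apply/eqP/commgP => //; apply: commute_sym.
Qed.

Theorem theoremD (G : groupType)
    (htf : torsion_free G) (hAH : algebraically_hyperbolic G) : CSA G.
Proof.
have [CT noHZ] := hAH.
move=> M maxM g Mg; have [sM abM _] := maxM.
have centM := maximal_abelian_centralizer CT maxM.
apply/seteqP; split=> [y [[x Mx exy] My]|_ ->]; last first.
  by have [M1 _ _] := sM; split=> //; exists 1; rewrite ?conj1g.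
apply: contrapT => y1.
have x1 : x <> 1 by move=> x1; apply: y1; rewrite -exy x1 conj1g.
(* Both inclusions hold because [x] and [y = x ^ g] have centralizer [M]. *)
have nMg : normalizes M g.
  move=> h; split=> Mh.
  - apply: (centM x) => //; apply: (@conjg_inj _ g).
    by rewrite !conjMg exy; apply: abM.
  - apply: (centM y) => //; rewrite -exy /commute -!conjMg.
    by congr (_ ^ g); apply: abM.
apply: noHZ; exists [set h * c | h in M & c in range (expgz g)], M, (range (expgz g)).
split.
- apply: semidirect_of_normalizes => //; first exact: cyclic_subgroup.
  + by move=> _ [n _ <-]; exact: (expgz_in n (normalizer_subgroup M) nMg).
    (* A nontrivial power of [g] lying in [M] would commute with [g], putting
       [g] in [M]. *)
  + move=> z Mz [n _ egn]; apply: contrapT => z1; apply: Mg.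
    apply: (centM _ _ Mz z1); rewrite -egn.
    exact/commute_sym/commute_expgz.
- by move=> M1; apply: x1; have := Mx; rewrite M1.
- apply: locally_cyclic_of_dependent => // a b Ma Mb.
  exact: AH_dependent (abM _ _ Ma Mb).
- apply: cyclic_iso_Z => // g1; apply: Mg; rewrite g1.
  by have [] := sM.
Qed.
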